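(* Let $\mathcal{C}$ be a multiring category over $\Bbbk$ with left duals, with unit decomposition $1=\oplus_{i\in I}1_i$, and let $(A,m_A,u_A)$ be an algebra in $\mathcal{C}$. Suppose $A_{ll}=0$ for some $l\in I$. Then $A_{lj}=A_{jl}=0$ for all $j\in I$. Consequently, $A=A_J$ for $J=\{i\in I\mid A_{ii}\neq 0\}$.
   Context: $\Bbbk$ is an algebraically closed field; monoidal categories are assumed strict, with tensor product $\otimes$ and unit object $1$. A multiring category over $\Bbbk$ is a locally finite (finite-dimensional Hom spaces, all objects of finite length) $\Bbbk$-linear abelian monoidal category with bilinear and biexact tensor product. ''With left duals'' means every object has a left dual. For such $\mathcal{C}$ the unit object is a finite direct sum $1=\oplus_{i\in I}1_i$ of pairwise non-isomorphic simple objects $1_i$ (the images of the primitive idempotents of $\mathrm{End}(1)$), and $1_i\otimes 1_j=0$ for $i\neq j$. Every object $X$ decomposes as $X=\oplus_{i,j\in I}X_{ij}$ with $X_{ij}=1_i\otimes X\otimes 1_j$. For $J\subseteq I$: $1_J:=\oplus_{i\in J}1_i$ and $X_J:=1_J\otimes X\otimes 1_J$ (identified with $\oplus_{i,j\in J}X_{ij}$); for $J=\emptyset$ these are zero objects. The equality $A=A_J$ is understood via the canonical inclusion $A_J\to A$. *)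

(* Defs.v *)
From mathcomp Require Import all_boot all_order all_algebra.
From mathcomp Require Import boolp.
Set Implicit Arguments.
Unset Strict Implicit.
Unset Printing Implicit Defensive.
Import GRing.Theory.
Local Open Scope ring_scope.

Declare Scope cat_scope.
Delimit Scope cat_scope with cat.

(* Mor X Y : vectType k, i.e. Hom spaces are finite-dimensional over k. *)
Record linCat (k : fieldType) := LinCat {
  obj :> Type;
  Mor : obj -> obj -> vectType k;
  idm : forall X, Mor X X;
  homc : forall X Y Z, Mor Y Z -> Mor X Y -> Mor X Z;
  hom1c : forall X Y (f : Mor X Y), homc (idm Y) f = f;
  homc1 : forall X Y (f : Mor X Y), homc f (idm X) = f;
  homcA : forall X Y Z W (h : Mor Z W) (g : Mor Y Z) (f : Mor X Y),
    homc h (homc g f) = homc (homc h g) f;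
  homc_linearl : forall X Y Z (a : k) (g g' : Mor Y Z) (f : Mor X Y),
    homc (a *: g + g') f = a *: homc g f + homc g' f;
  homc_linearr : forall X Y Z (a : k) (g : Mor Y Z) (f f' : Mor X Y),
    homc g (a *: f + f') = a *: homc g f + homc g f'
}.
Arguments Mor {k l} X Y.
Arguments idm {k l} X.
Arguments homc {k l X Y Z} g f.

Notation "g \c f" := (homc g f) (at level 45, left associativity) : cat_scope.
Local Open Scope cat_scope.

Section LinCat.
Context {k : fieldType} {C : linCat k}.
Implicit Types X Y Z W K : C.

Definition homOfEq X Y (e : X = Y) : Mor X Y :=
  match e in _ = Z return Mor X Z with erefl => idm X end.

Definition is_zero X : Prop :=
  (forall Y (f : Mor X Y), f = 0) /\ (forall Y (f : Mor Y X), f = 0).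

Definition is_iso X Y (f : Mor X Y) : Prop :=
  exists g : Mor Y X, g \c f = idm X /\ f \c g = idm Y.

Definition isomorphic X Y : Prop := exists f : Mor X Y, is_iso f.

Definition is_mono X Y (f : Mor X Y) : Prop :=
  forall W (g h : Mor W X), f \c g = f \c h -> g = h.

Definition is_epi X Y (f : Mor X Y) : Prop :=
  forall W (g h : Mor Y W), g \c f = h \c f -> g = h.

Definition is_kernel X Y K (f : Mor X Y) (i : Mor K X) : Prop :=
  f \c i = 0 /\
  forall W (g : Mor W X), f \c g = 0 -> exists! h : Mor W K, i \c h = g.

Definition is_cokernel X Y K (f : Mor X Y) (p : Mor Y K) : Prop :=
  p \c f = 0 /\
  forall W (g : Mor Y W), g \c f = 0 -> exists! h : Mor K W, h \c p = g.

Definition short_exact X Y Z (i : Mor X Y) (p : Mor Y Z) : Prop :=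
  is_kernel p i /\ is_cokernel i p.

Definition is_simple X : Prop :=
  ~ is_zero X /\
  forall Y (i : Mor Y X), is_mono i -> is_zero Y \/ is_iso i.

(* X has a composition series, built by successive extensions by simples. *)
Inductive finite_length : C -> Prop :=
| finite_length0 X : is_zero X -> finite_length X
| finite_lengthS X Y S (i : Mor X Y) (p : Mor Y S) :
    short_exact i p -> is_simple S -> finite_length X -> finite_length Y.

End LinCat.

Record abelianCat (k : fieldType) := AbelianCat {
  abCat :> linCat k;
  zero : abCat;
  zeroP : is_zero zero;
  biprod : abCat -> abCat -> abCat;
  in1 : forall X Y, Mor X (biprod X Y);
  in2 : forall X Y, Mor Y (biprod X Y);
  pr1 : forall X Y, Mor (biprod X Y) X;
  pr2 : forall X Y, Mor (biprod X Y) Y;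
  pr1_in1 : forall X Y, pr1 X Y \c in1 X Y = idm X;
  pr2_in2 : forall X Y, pr2 X Y \c in2 X Y = idm Y;
  pr1_in2 : forall X Y, pr1 X Y \c in2 X Y = 0;
  pr2_in1 : forall X Y, pr2 X Y \c in1 X Y = 0;
  in_pr : forall X Y,
    in1 X Y \c pr1 X Y + in2 X Y \c pr2 X Y = idm (biprod X Y);
  has_kernels : forall (X Y : abCat) (f : Mor X Y),
    exists (K : abCat) (i : Mor K X), is_kernel f i;
  has_cokernels : forall (X Y : abCat) (f : Mor X Y),
    exists (K : abCat) (p : Mor Y K), is_cokernel f p;
  mono_normal : forall (X Y : abCat) (i : Mor X Y), is_mono i ->
    exists (Z : abCat) (f : Mor Y Z), is_kernel f i;
  epi_normal : forall (X Y : abCat) (p : Mor X Y), is_epi p ->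
    exists (Z : abCat) (f : Mor Z X), is_cokernel f p
}.
Arguments zero {k a}.
Arguments biprod {k a} X Y.
Arguments in1 {k a X Y}.
Arguments in2 {k a X Y}.
Arguments pr1 {k a X Y}.
Arguments pr2 {k a X Y}.

(* The monoidal structure is strict: associativity and unitality are equalities
   of objects, and on morphisms they hold up to the transports homOfEq.  The
   pentagon and triangle then hold by proof irrelevance of object equalities. *)
Record multiringCat (k : fieldType) := MultiringCat {
  mrCat :> abelianCat k;
  fin_length : forall X : mrCat, finite_length X;
  tens : mrCat -> mrCat -> mrCat;
  tensm : forall X X' Y Y' : mrCat,
    Mor X X' -> Mor Y Y' -> Mor (tens X Y) (tens X' Y');
  tunit : mrCat;
  tensm_id : forall X Y : mrCat, tensm (idm X) (idm Y) = idm (tens X Y);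
  tensm_comp : forall (X X' X'' Y Y' Y'' : mrCat)
      (f : Mor X X') (f' : Mor X' X'') (g : Mor Y Y') (g' : Mor Y' Y''),
    tensm (f' \c f) (g' \c g) = tensm f' g' \c tensm f g;
  tensA : forall X Y Z : mrCat, tens X (tens Y Z) = tens (tens X Y) Z;
  tens1o : forall X : mrCat, tens tunit X = X;
  tenso1 : forall X : mrCat, tens X tunit = X;
  tensmA : forall (X X' Y Y' Z Z' : mrCat)
      (f : Mor X X') (g : Mor Y Y') (h : Mor Z Z'),
    homOfEq (tensA X' Y' Z') \c tensm f (tensm g h)
      = tensm (tensm f g) h \c homOfEq (tensA X Y Z);
  tens1m : forall (X Y : mrCat) (f : Mor X Y),
    homOfEq (tens1o Y) \c tensm (idm tunit) f = f \c homOfEq (tens1o X);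
  tensm1 : forall (X Y : mrCat) (f : Mor X Y),
    homOfEq (tenso1 Y) \c tensm f (idm tunit) = f \c homOfEq (tenso1 X);
  tensm_linearl : forall (X X' Y Y' : mrCat) (a : k)
      (f f' : Mor X X') (g : Mor Y Y'),
    tensm (a *: f + f') g = a *: tensm f g + tensm f' g;
  tensm_linearr : forall (X X' Y Y' : mrCat) (a : k)
      (f : Mor X X') (g g' : Mor Y Y'),
    tensm f (a *: g + g') = a *: tensm f g + tensm f g';
  tens_exactl : forall (W X Y Z : mrCat) (i : Mor X Y) (p : Mor Y Z),
    short_exact i p -> short_exact (tensm (idm W) i) (tensm (idm W) p);
  tens_exactr : forall (W X Y Z : mrCat) (i : Mor X Y) (p : Mor Y Z),
    short_exact i p -> short_exact (tensm i (idm W)) (tensm p (idm W))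
}.
Arguments tens {k m} X Y.
Arguments tensm {k m X X' Y Y'} f g.
Arguments tunit {k m}.

Notation "X \ox Y" := (tens X Y) (at level 40, left associativity) : cat_scope.
Notation "f \om g" := (tensm f g) (at level 40, left associativity) : cat_scope.

Section Multiring.
Context {k : fieldType} {C : multiringCat k}.
Implicit Types X Y : C.

(* Convention: ev : X^* (x) X -> 1 and coev : 1 -> X (x) X^*. *)
Definition is_left_dual X Xs (ev : Mor (Xs \ox X) tunit)
    (coev : Mor tunit (X \ox Xs)) : Prop :=
  homOfEq (tenso1 X) \c (idm X \om ev) \c homOfEq (esym (tensA X Xs X))
    \c (coev \om idm X) \c homOfEq (esym (tens1o X)) = idm X
  /\
  homOfEq (tens1o Xs) \c (ev \om idm Xs) \c homOfEq (tensA Xs X Xs)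
    \c (idm Xs \om coev) \c homOfEq (esym (tenso1 Xs)) = idm Xs.

Definition is_algebra (A : C) (m : Mor (A \ox A) A) (u : Mor tunit A) : Prop :=
  [/\ m \c (m \om idm A) \c homOfEq (tensA A A A) = m \c (idm A \om m),
      m \c (u \om idm A) = homOfEq (tens1o A)
    & m \c (idm A \om u) = homOfEq (tenso1 A)].

End Multiring.

Definition has_left_duals (k : fieldType) (C : multiringCat k) : Prop :=
  forall X : C, exists (Xs : C) (ev : Mor (Xs \ox X) tunit)
    (coev : Mor tunit (X \ox Xs)), is_left_dual ev coev.

(* A decomposition 1 = \oplus_(i in I) 1_i; 1_i is then the image of the
   idempotent uin i \c upr i of End(1), primitive because 1_i is simple. *)
Record unitDecomp (k : fieldType) (C : multiringCat k) (I : finType) :=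
    UnitDecomp {
  uobj :> I -> C;
  uin : forall i, Mor (uobj i) tunit;
  upr : forall i, Mor tunit (uobj i);
  upr_uin : forall i, upr i \c uin i = idm (uobj i);
  upr_uin0 : forall i j, i != j -> upr i \c uin j = 0;
  uin_upr : \sum_(i : I) (uin i \c upr i) = idm tunit;
  uobj_simple : forall i, is_simple (uobj i);
  uobj_noniso : forall i j, i != j -> ~ isomorphic (uobj i) (uobj j)
}.
Arguments uin {k C I} u i.
Arguments upr {k C I} u i.

Section Blocks.
Context {k : fieldType} {C : multiringCat k} {I : finType}.
Variable U : unitDecomp C I.

Definition block (X : C) (i j : I) : C := U i \ox X \ox U j.

Fixpoint unitSum (s : seq I) : C :=
  if s is i :: s' then biprod (U i) (unitSum s') else zero.

Fixpoint unitSumIncl (s : seq I) : Mor (unitSum s) tunit :=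
  if s is i :: s' then uin U i \c pr1 + unitSumIncl s' \c pr2 else 0.

Definition unitPart (J : {set I}) : C := unitSum (enum J).

Definition unitPartIncl (J : {set I}) : Mor (unitPart J) tunit :=
  unitSumIncl (enum J).

Definition part (J : {set I}) (X : C) : C := unitPart J \ox X \ox unitPart J.

Definition partIncl (J : {set I}) (X : C) : Mor (part J X) X :=
  homOfEq (etrans (tenso1 (tunit \ox X)) (tens1o X))
    \c (unitPartIncl J \om idm X \om unitPartIncl J).

Definition diagSupport (X : C) : {set I} :=
  [set i | `[< ~ is_zero (block X i i) >]].

End Blocks.

(* Main.v *)
Require Import Defs.
From HB Require Import structures.
From mathcomp Require Import all_boot all_order all_algebra.
From mathcomp Require Import boolp.
Set Implicit Arguments.
Unset Strict Implicit.
Unset Printing Implicit Defensive.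
Local Open Scope cat_scope.

(** An endomorphism [g] of the unit acts on every object [X] from the left, as
    [g \om idm X], and from the right, as [idm X \om g], both read as
    endomorphisms of [X] ([actl] and [actr]).  These actions are natural in [X]
    and both are [g] itself on the unit object.  With [e i] the idempotent of
    [End(1)] cut out by [1_i] ([unitIdem]), the block [X_ij] is the image of
    [actr (e j) X \c actl (e i) X], so it vanishes iff this idempotent does
    ([is_zero_blockE]).

    Suppose now that [A_ll = 0].  By naturality,
    [u \c e l = u \c e l \c e l = actr (e l) A \c actl (e l) A \c u = 0]: the
    unit of [A] has no component on [1_l] ([unit_component0]).  The unit axioms
    of [A] say that [actl g A] and [actr g A] depend only on [u \c g], hence
    [e l] acts by zero on [A] from both sides, and [A_lj] and [A_jl] vanish.

    Finally [1_J] is a retract of [1], with idempotent the sum of the [e i] over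
    [J].  For [J] the diagonal support, the omitted [e i] act by zero on [A], so
    that this sum acts as [\sum_i e i = idm 1] does, that is, as the identity;
    this makes the split monomorphism [A_J -> A] invertible. *)

(** * Linearity and transport along equalities of objects *)

Section LinearMaps.
Import GRing.Theory.
Local Open Scope ring_scope.
Context {k : fieldType} {V W : vectType k} (f : V -> W).
Hypothesis f_lin : forall (a : k) x y, f (a *: x + y) = a *: f x + f y.

Let F : {linear V -> W} := HB.pack f (GRing.isLinear.Build _ _ _ _ f f_lin).

Lemma linear_fun0 : f 0 = 0.
Proof. exact: (linear0 F). Qed.

Lemma linear_funD x y : f (x + y) = f x + f y.
Proof. exact: (linearD F). Qed.

Lemma linear_fun_sum (I : Type) (r : seq I) (P : pred I) (E : I -> V) :
  f (\sum_(i <- r | P i) E i) = \sum_(i <- r | P i) f (E i).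
Proof. exact: (linear_sum F). Qed.

End LinearMaps.

Local Open Scope ring_scope.
Import GRing.Theory.

Section LinCatTheory.
Context {k : fieldType} {C : linCat k}.
Implicit Types X Y Z : C.

Lemma hom0c X Y Z (f : Mor X Y) : (0 : Mor Y Z) \c f = 0.
Proof.
exact: (@linear_fun0 _ _ _ (fun g : Mor Y Z => g \c f))
  (fun a g g' => homc_linearl a g g' f).
Qed.

Lemma homc0 X Y Z (g : Mor Y Z) : g \c (0 : Mor X Y) = 0.
Proof. exact: linear_fun0 (fun a => homc_linearr a g). Qed.

Lemma homcDl X Y Z (g g' : Mor Y Z) (f : Mor X Y) :
  (g + g') \c f = g \c f + g' \c f.
Proof.
exact: (@linear_funD _ _ _ (fun g : Mor Y Z => g \c f))
  (fun a g g' => homc_linearl a g g' f) _ _.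
Qed.

Lemma homcDr X Y Z (g : Mor Y Z) (f f' : Mor X Y) :
  g \c (f + f') = g \c f + g \c f'.
Proof. exact: linear_funD (fun a => homc_linearr a g) _ _. Qed.

Lemma is_zeroE X : is_zero X <-> idm X = 0.
Proof.
split=> [[] // |X0]; split=> Y f; first by rewrite -(homc1 f) X0 homc0.
by rewrite -(hom1c f) X0 hom0c.
Qed.

Lemma homOfEqK X Y (p : X = Y) : homOfEq (esym p) \c homOfEq p = idm X.
Proof. by case: Y / p; rewrite /= hom1c. Qed.

Lemma homOfEqVK X Y (p : X = Y) : homOfEq p \c homOfEq (esym p) = idm Y.
Proof. by case: Y / p; rewrite /= hom1c. Qed.

Lemma homOfEq_trans X Y Z (p : X = Y) (q : Y = Z) :
  homOfEq (etrans p q) = homOfEq q \c homOfEq p.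
Proof. by case: Z / q; case: Y / p; rewrite /= hom1c. Qed.

(** Conjugating a commutative square by its invertible sides. *)
Lemma homOfEq_natV X X' Y Y' (p : X = X') (q : Y = Y')
    (f : Mor X Y) (f' : Mor X' Y') :
  homOfEq q \c f = f' \c homOfEq p ->
  homOfEq (esym q) \c f' = f \c homOfEq (esym p).
Proof. by case: X' / p f'; case: Y' / q => f' /=; rewrite !hom1c !homc1. Qed.

Lemma homOfEq_conj0 X Y (p : X = Y) (f : Mor X X) :
  homOfEq p \c f \c homOfEq (esym p) = 0 <-> f = 0.
Proof. by case: Y / p; rewrite /= hom1c homc1. Qed.

End LinCatTheory.

(** * The actions of endomorphisms of the unit *)

Section UnitActions.
Context {k : fieldType} {C : multiringCat k}.
Implicit Types (X Y : C) (g h : Mor (tunit : C) tunit).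

Definition actl g X : Mor X X :=
  homOfEq (tens1o X) \c (g \om idm X) \c homOfEq (esym (tens1o X)).

Definition actr g X : Mor X X :=
  homOfEq (tenso1 X) \c (idm X \om g) \c homOfEq (esym (tenso1 X)).

Lemma tens0m (X X' Y Y' : C) (f : Mor Y Y') : (0 : Mor X X') \om f = 0.
Proof.
apply: (@linear_fun0 _ _ _ (fun g : Mor X X' => g \om f)) => a g g'.
exact: tensm_linearl.
Qed.

Lemma tensm0 (X X' Y Y' : C) (f : Mor X X') : f \om (0 : Mor Y Y') = 0.
Proof.
by apply: (@linear_fun0 _ _ _ (tensm f)) => a g g'; exact: tensm_linearr.
Qed.

Lemma actl_linear X a g h : actl (a *: g + h) X = a *: actl g X + actl h X.
Proof. by rewrite /actl tensm_linearl homc_linearr homc_linearl. Qed.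

Lemma actr_linear X a g h : actr (a *: g + h) X = a *: actr g X + actr h X.
Proof. by rewrite /actr tensm_linearr homc_linearr homc_linearl. Qed.

Lemma actl1 X : actl (idm tunit) X = idm X.
Proof. by rewrite /actl tensm_id homc1 homOfEqVK. Qed.

Lemma actr1 X : actr (idm tunit) X = idm X.
Proof. by rewrite /actr tensm_id homc1 homOfEqVK. Qed.

Lemma actl_nat g X Y (f : Mor X Y) : f \c actl g X = actl g Y \c f.
Proof.
rewrite /actl -!homcA (homOfEq_natV (tens1m f)) !homcA -tens1m; congr (_ \c _).
by rewrite -!homcA -!tensm_comp !homc1 !hom1c.
Qed.

Lemma actr_nat g X Y (f : Mor X Y) : f \c actr g X = actr g Y \c f.
Proof.
rewrite /actr -!homcA (homOfEq_natV (tensm1 f)) !homcA -tensm1; congr (_ \c _).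
by rewrite -!homcA -!tensm_comp !homc1 !hom1c.
Qed.

(** The two identifications of [1 \ox 1] with [1] are the same equality of
    objects, so the left action on the unit can be computed by the right unit
    law, and conversely. *)
Lemma actl_unit g : actl g tunit = g.
Proof.
rewrite /actl (Prop_irrelevance (tens1o tunit) (tenso1 tunit)) tensm1.
by rewrite -homcA homOfEqVK homc1.
Qed.

Lemma actr_unit g : actr g tunit = g.
Proof.
rewrite /actr (Prop_irrelevance (tenso1 tunit) (tens1o tunit)) tens1m.
by rewrite -homcA homOfEqVK homc1.
Qed.

Definition unit3 X : tunit \ox X \ox tunit = X :=
  etrans (tenso1 (tunit \ox X)) (tens1o X).

(** Acting on both sides is tensoring on both sides: the right action on [X]
    is transported to [1 \ox X], where it commutes with [g \om idm X]. *)
Lemma actrlE g h X :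
  actr h X \c actl g X =
    homOfEq (unit3 X) \c (g \om idm X \om h) \c homOfEq (esym (unit3 X)).
Proof.
rewrite {1}/actl !homcA -actr_nat /actr.
have -> : homOfEq (esym (unit3 X)) =
    homOfEq (esym (tenso1 (tunit \ox X))) \c homOfEq (esym (tens1o X)).
  by rewrite -homOfEq_trans; congr homOfEq; apply: Prop_irrelevance.
rewrite /unit3 homOfEq_trans -!homcA; congr (_ \c (_ \c _)).
rewrite (homcA (homOfEq _)) (homOfEq_natV (tensm1 (g \om idm X))).
by rewrite !homcA -tensm_comp hom1c homc1.
Qed.

End UnitActions.

(** * Blocks as images of idempotents *)

Section BlockIdempotents.
Context {k : fieldType} {C : multiringCat k} {I : finType}.
Variable U : unitDecomp C I.

Definition unitIdem (i : I) : Mor (tunit : C) tunit := uin U i \c upr U i.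

Lemma unitIdem_idem i : unitIdem i \c unitIdem i = unitIdem i.
Proof. by rewrite /unitIdem -homcA (homcA (upr U i)) upr_uin hom1c. Qed.

Lemma is_zero_blockE (X : C) i j :
  is_zero (block U X i j) <-> actr (unitIdem j) X \c actl (unitIdem i) X = 0.
Proof.
rewrite is_zeroE actrlE homOfEq_conj0 /unitIdem.
pose inc := uin U i \om idm X \om uin U j.
pose pro := upr U i \om idm X \om upr U j.
have proK : pro \c inc = idm (block U X i j).
  by rewrite -!tensm_comp !upr_uin hom1c !tensm_id.
have -> : (uin U i \c upr U i) \om idm X \om (uin U j \c upr U j) = inc \c pro.
  by rewrite -!tensm_comp hom1c.
split=> [id0 | e0]; first by rewrite -(homc1 inc) id0 homc0 hom0c.
by rewrite -[LHS]hom1c -proK -homcA (homcA inc) e0 hom0c homc0.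
Qed.

Fixpoint unitSumProj (s : seq I) : Mor (tunit : C) (unitSum U s) :=
  if s is i :: s' then in1 \c upr U i + in2 \c unitSumProj s' else 0.

Lemma upr_unitSumIncl i s : i \notin s -> upr U i \c unitSumIncl U s = 0.
Proof.
elim: s => [|j s IHs] /=; first by rewrite homc0.
rewrite inE negb_or => /andP[ij /IHs is0].
by rewrite homcDr !homcA is0 upr_uin0 // !hom0c addr0.
Qed.

Lemma unitSumProj_uin i s : i \notin s -> unitSumProj s \c uin U i = 0.
Proof.
elim: s => [|j s IHs] /=; first by rewrite hom0c.
rewrite inE negb_or eq_sym => /andP[ij /IHs is0].
by rewrite homcDl -!homcA is0 upr_uin0 // !homc0 addr0.
Qed.

Lemma unitSumInclK s : uniq s -> unitSumProj s \c unitSumIncl U s = idm _.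
Proof.
elim: s => [|i s IHs] /=.
  by move=> _; rewrite homc0; apply/esym/is_zeroE/zeroP.
case/andP=> is0 /IHs ids.
rewrite homcDl !homcDr -in_pr.
rewrite -!homcA !(homcA (upr U i)) upr_uin upr_unitSumIncl // hom1c hom0c homc0.
by rewrite !(homcA (unitSumProj s)) unitSumProj_uin // hom0c homc0 ids hom1c
  addr0 add0r.
Qed.

Lemma unitSumProjK s :
  unitSumIncl U s \c unitSumProj s = \sum_(i <- s) unitIdem i.
Proof.
elim: s => [|i s IHs] /=; first by rewrite homc0 big_nil.
rewrite big_cons homcDl !homcDr -!homcA.
rewrite !(homcA pr1) !(homcA pr2) pr1_in1 pr1_in2 pr2_in1 pr2_in2.
by rewrite !hom1c !hom0c !homc0 addr0 add0r IHs.
Qed.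

End BlockIdempotents.

(** * Algebras *)

Section Algebras.
Context {k : fieldType} {C : multiringCat k} {I : finType}.
Variables (U : unitDecomp C I) (A : C).
Variables (m : Mor (A \ox A) A) (u : Mor tunit A).
Hypothesis algA : is_algebra m u.

Lemma algebra_actl0 (g : Mor (tunit : C) tunit) : u \c g = 0 -> actl g A = 0.
Proof.
case: algA => _ unitl _ ug0.
rewrite /actl -unitl -(homcA m) -tensm_comp hom1c ug0.
by rewrite tens0m homc0 hom0c.
Qed.

Lemma algebra_actr0 (g : Mor (tunit : C) tunit) : u \c g = 0 -> actr g A = 0.
Proof.
case: algA => _ _ unitr ug0.
rewrite /actr -unitr -(homcA m) -tensm_comp hom1c ug0.
by rewrite tensm0 homc0 hom0c.
Qed.

(** A morphism from [1] restricted to [1_l] lands in the [l]-th diagonal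
    block, since the left and right actions of [End(1)] on [1] agree. *)
Lemma unit_component0 l : is_zero (block U A l l) -> u \c unitIdem U l = 0.
Proof.
move/is_zero_blockE => ell0; rewrite -unitIdem_idem -{1}[unitIdem U l]actr_unit.
by rewrite -[X in _ \c (_ \c X)]actl_unit homcA actr_nat -homcA actl_nat homcA
  ell0 hom0c.
Qed.

Lemma is_zero_diag_block l : is_zero (block U A l l) ->
  forall j, is_zero (block U A l j) /\ is_zero (block U A j l).
Proof.
move=> /unit_component0 ul0 j; split; apply/is_zero_blockE.
  by rewrite (algebra_actl0 ul0) homc0.
by rewrite (algebra_actr0 ul0) hom0c.
Qed.

Local Notation J := (diagSupport U A).
Local Notation eJ := (\sum_(i <- enum J) unitIdem U i).

Lemma unit_component_out i : i \notin J -> u \c unitIdem U i = 0.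
Proof. by rewrite inE => /asboolPn/contrapT/unit_component0. Qed.

(** The idempotents of the unit sum to [idm tunit], and [f] kills those outside
    [J]; the maps of interest are the left and right actions on [A]. *)
Lemma sum_diagSupport (W : vectType k) (f : Mor (tunit : C) tunit -> W) :
  (forall (a : k) g h, f (a *: g + h) = a *: f g + f h) ->
  (forall i, i \notin J -> f (unitIdem U i) = 0) -> f eJ = f (idm tunit).
Proof.
move=> f_lin f0; rewrite -(uin_upr U) !(linear_fun_sum f_lin) big_enum /=.
by rewrite [RHS](bigID (mem J)) /= [X in _ = _ + X]big1 ?addr0.
Qed.

(** [unitSumProj] tensored on both sides is always a left inverse of [partIncl];
    the other composite is the two-sided action of the idempotent of [1_J]. *)
Lemma is_iso_partIncl : is_iso (partIncl U J A).
Proof.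
pose q := unitSumProj U (enum J).
have qi : q \c unitPartIncl U J = idm _ by apply/unitSumInclK/enum_uniq.
have iq : unitPartIncl U J \c q = eJ by apply: unitSumProjK.
exists ((q \om idm A \om q) \c homOfEq (esym (unit3 A))); split.
  rewrite /partIncl -homcA (homcA (homOfEq _)) homOfEqK hom1c.
  by rewrite -!tensm_comp !qi hom1c !tensm_id.
rewrite /partIncl homcA -(homcA (homOfEq _)) -!tensm_comp iq hom1c -actrlE.
have -> : actl eJ A = idm A.
  rewrite -actl1; apply: (sum_diagSupport (@actl_linear _ _ A)) => i.
  by move/unit_component_out/algebra_actl0.
rewrite homc1 -actr1; apply: (sum_diagSupport (@actr_linear _ _ A)) => i.
by move/unit_component_out/algebra_actr0.
Qed.

End Algebras.

Theorem proposition5p12 (k : closedFieldType) (C : multiringCat k)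
    (hC : has_left_duals C) (I : finType) (U : unitDecomp C I)
    (A : C) (m : Mor (A \ox A) A) (u : Mor tunit A) (hA : is_algebra m u) :
  (forall l : I, is_zero (block U A l l) ->
     forall j : I, is_zero (block U A l j) /\ is_zero (block U A j l)) /\
  is_iso (partIncl U (diagSupport U A) A).
Proof.
by split; [exact: (is_zero_diag_block hA) | exact: (is_iso_partIncl U hA)].
Qed.
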